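(* Consider the linear probing filter (defined in the context) with table size $t$ a power of two, built by inserting the keys of a set $S\subseteq[u]$ with $|S|=n\le\frac23 t$ in some order. Assume that $h$ and $s$ are independent, that $h:[u]\to[t]$ is 5-independent, and that $s:[u]\to[2^b]$ is universal. Then for any given key $q\in[u]\setminus S$, the probability that the filter answers ``yes'' on $q$ (a false positive) is at most $C/2^b$ for an absolute constant $C$.
   Context: Let $[s]=\{0,\dots,s-1\}$. A random hash function $h:[u]\to[t]$ is 5-independent if for any distinct $x_0,\dots,x_4\in[u]$ and any $y_0,\dots,y_4\in[t]$, $\Pr[h(x_i)=y_i\ \forall i]=1/t^5$. A random function $s:[u]\to[2^b]$ is universal if $\Pr[s(x)=s(y)]\le 1/2^b$ for all distinct $x,y\in[u]$; $s(x)$ is called the signature of $x$. Linear probing filter: an array $T$ of positions (indexed by nonnegative integers, wrap-around ignored), each either empty or holding a signature. To query $q$: scan positions $h(q),h(q)+1,\dots$ until the first empty position; answer ``yes'' if $s(q)$ is found among the scanned signatures, else ``no''. To insert $q$: if a query for $q$ answers ``yes'', do nothing; otherwise place $s(q)$ in the first empty position at or after $h(q)$. The filter starts empty and the keys of $S$ are inserted one by one. *)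

(* Defs.v *)
From HB Require Import structures.
From mathcomp Require Import all_boot all_order all_algebra.
Set Implicit Arguments. Unset Strict Implicit. Unset Printing Implicit Defensive.
Import Order.TTheory GRing.Theory Num.Theory.

(* A linear probing filter table: the list of occupied positions, each paired
   with the signature stored there.  Positions are arbitrary naturals (no
   wrap-around).  Insertions only ever write to empty positions, so the table
   has at most [size T] occupied positions; hence scanning [size T + 1]
   consecutive positions always reaches an empty one, and we use this as fuel. *)
Definition table := seq (nat * nat).

Definition lookup (T : table) (p : nat) : option nat :=
  match [seq e <- T | e.1 == p] with
  | [::] => None
  | e :: _ => Some e.2
  end.

Fixpoint scan_sigs (T : table) (fuel p : nat) : seq nat :=
  match fuel with
  | 0 => [::]
  | f.+1 => match lookup T p with
            | None => [::]
            | Some x => x :: scan_sigs T f p.+1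
            end
  end.

Fixpoint first_empty_from (T : table) (fuel p : nat) : nat :=
  match fuel with
  | 0 => p
  | f.+1 => match lookup T p with
            | None => p
            | Some _ => first_empty_from T f p.+1
            end
  end.

Definition query (h s : nat -> nat) (T : table) (q : nat) : bool :=
  s q \in scan_sigs T (size T).+1 (h q).

Definition insert (h s : nat -> nat) (T : table) (q : nat) : table :=
  if query h s T q then T else (first_empty_from T (size T).+1 (h q), s q) :: T.

Definition build (h s : nat -> nat) (keys : seq nat) : table :=
  foldl (insert h s) [::] keys.

Local Open Scope ring_scope.

Definition is_distr (R : realFieldType) (I : finType) (p : I -> R) : Prop :=
  (forall i, 0 <= p i) /\ (\sum_(i : I) p i = 1).

(* Random hash function h : [u] -> [t]: distribution ph on I, realization hf. *)
Definition maps_into (I : finType) (hf : I -> nat -> nat) (u t : nat) : Prop :=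
  forall i x, (x < u)%N -> (hf i x < t)%N.

Definition five_independent (R : realFieldType) (I : finType) (ph : I -> R)
    (hf : I -> nat -> nat) (u t : nat) : Prop :=
  forall (xs ys : 5.-tuple nat),
    uniq xs -> all (fun x => (x < u)%N) xs -> all (fun y => (y < t)%N) ys ->
    \sum_(i : I) ph i * ([forall k : 'I_5, hf i (tnth xs k) == tnth ys k])%:R
      = 1 / (t%:R ^+ 5).

Definition universal (R : realFieldType) (J : finType) (ps : J -> R)
    (sf : J -> nat -> nat) (u b : nat) : Prop :=
  forall x y, (x < u)%N -> (y < u)%N -> x != y ->
    \sum_(j : J) ps j * (sf j x == sf j y)%:R <= 1 / (2%:R ^+ b).

Definition false_pos_prob (R : realFieldType) (I J : finType)
    (ph : I -> R) (hf : I -> nat -> nat) (ps : J -> R) (sf : J -> nat -> nat)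
    (keys : seq nat) (q : nat) : R :=
  \sum_(i : I) \sum_(j : J)
    ph i * ps j * (query (hf i) (sf j) (build (hf i) (sf j) keys) q)%:R.

(* Main.v *)
(* If the filter answers yes on q, some key x of S with s(x) = s(q) was stored
   in the run of occupied positions scanned from h(q).  Extended maximally to
   the left, this run is an interval [a, p] containing h(q) and h(x), and the
   keys stored in it all hash into it, so at least p + 1 - a keys of S hash into
   [a, p].  This event depends on h only, hence by universality and independence
   it suffices to bound the expected number of such x by a constant.

   Relative to z = h(q), cover [a, p] by a window [z - al m, z + (be + 1) m)
   with m a power of two, al <= 16, be <= 15, and length l at most 5/4 of that of
   [a, p].  Given h(q) = z, the number N of keys hashed into the window has mean
   mu <= 2/3 l, while N >= 4/5 l, whence N = O((N - mu)^4 / l^3).  By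
   5-independence the fourth central moment of N given h(q) = z is that of a
   binomial variable, O(l^2), so each window contributes O(1/m), which is summable
   over the scales m = 2^i. *)
Require Import Defs.
From HB Require Import structures.
From mathcomp Require Import all_boot all_order all_algebra.
From mathcomp Require Import zify ring lra.
Import Order.TTheory GRing.Theory Num.Theory.
Set Implicit Arguments. Unset Strict Implicit. Unset Printing Implicit Defensive.
Local Open Scope ring_scope.

(** * Occupied positions, scans and the insertion history *)

Definition occupied (T : table) : seq nat := map fst T.

Lemma lookup_None T p : lookup T p = None -> p \notin occupied T.
Proof.
rewrite /lookup; case E: [seq e <- T | e.1 == p] => [|//] _.
apply/mapP=> -[e eT pe].
have : e \in [seq e <- T | e.1 == p] by rewrite mem_filter eT pe eqxx.
by rewrite E.
Qed.

Lemma lookup_Some T p v : lookup T p = Some v -> (p, v) \in T.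
Proof.
rewrite /lookup; case E: [seq e <- T | e.1 == p] => [//|e l] [ev].
have : e \in [seq e <- T | e.1 == p] by rewrite E mem_head.
by rewrite mem_filter => /andP[/eqP ep eT]; rewrite -ev -ep -surjective_pairing.
Qed.

Definition filled (O : seq nat) (a b : nat) : Prop :=
  forall r, (a <= r < b)%N -> r \in O.

Lemma filled_size O a b : filled O a b -> (b - a <= size O)%N.
Proof.
move=> F; rewrite -[X in (X <= _)%N](size_iota a).
apply: uniq_leq_size; first exact: iota_uniq.
by move=> r; rewrite mem_iota => ?; apply: F; lia.
Qed.

Lemma filled_left O a b : a \in O -> filled O a.+1 b -> filled O a b.
Proof.
move=> aO F r ar; case: (eqVneq r a) => [->//|ra].
by apply: F; lia.
Qed.

Lemma scan_sigsP T f p v : v \in scan_sigs T f p ->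
  exists2 r, (r, v) \in T & (p <= r)%N /\ filled (occupied T) p r.+1.
Proof.
elim: f p => [//|f IH] p /=.
case E: (lookup T p) => [w|//]; have wT := lookup_Some E.
have pO : p \in occupied T by apply/mapP; exists (p, w).
rewrite inE => /orP[/eqP ->|/IH[r rT [pr F]]].
  exists p => //; split=> // r ?; have -> : r = p by lia.
  exact: pO.
by exists r => //; split; [exact: ltnW|exact: filled_left].
Qed.

Lemma first_empty_fromP T f p (r := first_empty_from T f p) :
  [/\ (p <= r)%N, filled (occupied T) p r & (r \notin occupied T) || (r == p + f)%N].
Proof.
rewrite {}/r; elim: f p => [|f IH] p /=.
  by split=> //; [move=> r; lia|rewrite addn0 eqxx orbT].
case E: (lookup T p) => [w|].
  have pO : p \in occupied T.
    by apply/mapP; exists (p, w); rewrite ?(lookup_Some E).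
  have [h1 h2 h3] := IH p.+1.
  by split; [exact: ltnW|exact: filled_left|rewrite addnS -addSn].
by split=> //; [move=> r; lia|rewrite (lookup_None E)].
Qed.

(** The fuel suffices: exhausting it would take [size T + 1] distinct occupied positions. *)
Lemma first_empty_notin T p :
  first_empty_from T (size T).+1 p \notin occupied T.
Proof.
have [_ F /orP[//|/eqP E]] := first_empty_fromP T (size T).+1 p.
by have := filled_size F; rewrite E /occupied size_map; lia.
Qed.

(* [G] records, for each occupied position, the key whose insertion filled it. *)
Record history (h s : nat -> nat) (keys : seq nat) (T : table)
    (G : seq (nat * nat)) : Prop := History {
  history_table : T = [seq (g.1, s g.2) | g <- G];
  history_uniq : uniq [seq g.2 | g <- G];
  history_sub : {subset [seq g.2 | g <- G] <= keys};
  history_le : forall g, g \in G -> (h g.2 <= g.1)%N;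
  history_filled : forall g, g \in G -> filled (occupied T) (h g.2) g.1.+1 }.

(** A skipped key leaves [G] unchanged. A placed key [x] is prepended: the probe fills the positions
    before [p], the new entry fills [p], and older filled intervals survive because entries are
    never removed. *)
Lemma build_history h s keys : uniq keys ->
  exists G, history h s keys (build h s keys) G.
Proof.
elim/last_ind: keys => [_|ks x IH]; first by exists [::]; split.
rewrite rcons_uniq => /andP[xks /IH[G HG]].
rewrite /build foldl_rcons -/(build h s ks); set T := build h s ks in HG *.
rewrite /insert; case: ifP => _.
  exists G; case: HG => ET U S L Fi; split=> // y yG.
  by rewrite mem_rcons inE S ?orbT.
set p := first_empty_from _ _ _.
have [hp F _] := first_empty_fromP T (size T).+1 (h x).
exists ((p, x) :: G); case: HG => ET U S L Fi; split.
- by rewrite [in LHS]ET.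
- by rewrite /= U andbT; apply: contra xks => /S.
- by move=> y /=; rewrite mem_rcons !inE => /orP[->//|/S->]; rewrite orbT.
- by move=> g; rewrite inE => /orP[/eqP->|/L].
move=> g; rewrite inE => /orP[/eqP->|gG] r /= hr.
  rewrite /occupied /= inE; case: eqVneq => //= rp.
  by apply: F; rewrite -/p; lia.
by rewrite /occupied /= inE (Fi g gG) ?orbT.
Qed.

(* Extending the filled positions around [h q] to the left as far as possible
   gives an interval that no probe sequence enters from outside, so every key
   stored in it also hashes into it. *)
Lemma query_overfull h s keys q : uniq keys ->
  query h s (build h s keys) q ->
  exists x a p, [/\ x \in keys, s x = s q, (a <= h q <= p)%N, (a <= h x <= p)%N
    & (p.+1 - a <= count (fun y => a <= h y <= p) keys)%N].
Proof.
move=> Uk; have [G [ET U S L Fi]] := build_history h s Uk.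
rewrite /query => /scan_sigsP[p]; set T := build h s keys in ET Fi *.
rewrite {1}ET => /mapP[[p' x] gG /= [pp' sx]] [qp F]; subst p'.
(* A boolean form of [filled], so that [ex_minnP] can select the leftmost start [a]. *)
pose P a := all [in occupied T] (index_iota a p.+1).
have PP a : reflect (filled (occupied T) a p.+1) (P a).
  apply: (iffP allP) => H r; last by rewrite mem_index_iota => /H.
  by move=> ar; apply: H; rewrite mem_index_iota.
have Phx : P (h x) by apply/PP; exact: (Fi (p, x)).
have Pq : P (h q) by apply/PP.
case: (ex_minnP (ex_intro P _ Pq)) => a /PP Fa amin.
have hxp := L _ gG; rewrite /= in hxp.
exists x, a, p; split=> //.
- by apply: S; apply/mapP; exists (p, x).
- by rewrite (amin _ Pq).
- by rewrite (amin _ Phx).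
pose G' := [seq g <- G | (a <= g.1 <= p)%N].
have sz : (p.+1 - a <= size G')%N.
  rewrite -(size_map fst); rewrite -[X in (X <= _)%N](size_iota a).
  apply: uniq_leq_size; first exact: iota_uniq.
  move=> r; rewrite mem_iota => ra.
  have : r \in occupied T by apply: Fa; lia.
  rewrite /occupied ET -map_comp => /mapP[g gG' /= rg].
  by apply/mapP; exists g => //; rewrite mem_filter gG' andbT -rg; lia.
apply: leq_trans sz _; rewrite -size_filter -(size_map snd G').
apply: uniq_leq_size.
  exact: subseq_uniq (map_subseq _ (filter_subseq _ _)) U.
move=> y /mapP[g]; rewrite mem_filter => /andP[/andP[ag gp] gG'] ->.
rewrite mem_filter S ?andbT; last by apply: map_f.
(* The probe interval of [y] reaches [g.1 >= a]; joined with [[a, p]] it fills [[h y, p]], and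
   minimality gives [a <= h y]. *)
rewrite (leq_trans (L _ gG') gp) andbT; apply: amin; apply/PP => r hr.
case: (leqP a r) => ar; first by apply: Fa; lia.
case/andP: hr => hr _; apply: (Fi _ gG').
by rewrite hr ltnS ltnW // (leq_trans ar).
Qed.

(** * Covering intervals by dyadic windows *)

Definition window (z m al be y : nat) : bool :=
  (z <= y + al * m)%N && (y < z + be.+1 * m)%N.

(** Take [i = trunc_log 2 L - 3], so that [L] spans between 8 and 16 steps of [2 ^ i]; lengths below
    16 use unit steps. *)
Lemma scale_exists L : exists2 i : nat,
  (L < 16 * 2 ^ i)%N & (i == 0%N) || (8 * 2 ^ i <= L)%N.
Proof.
case: (ltnP L 16) => hL; first by exists 0%N.
have h4 : (4 <= trunc_log 2 L)%N by apply: trunc_log_max.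
have L0 : (0 < L)%N by lia.
have := trunc_logP (isT : (1 < 2)%N) L0; have := trunc_log_ltn L (isT : (1 < 2)%N).
rewrite -(subnK h4); move: (trunc_log 2 L - 4)%N => k.
rewrite -addSn !expnD => h1 h2.
by exists k.+1; rewrite ?expnS //= in h1 *; lia.
Qed.

(** Rounding both ends outward to multiples of [m = 2 ^ i] from [z] adds less than [2 * m], at most
    a quarter of the length when it is at least [8 * m]. With [m = 1] nothing is added. *)
Lemma interval_window (a p z : nat) : (a <= z <= p)%N ->
  exists i al be : nat, [/\ (al < 17)%N, (be < 16)%N, (i <= p - a)%N,
    forall y, (a <= y <= p)%N -> window z (2 ^ i) al be y
    & (4 * ((al + be.+1) * 2 ^ i) <= 5 * (p.+1 - a))%N].
Proof.
move=> azp; have [i hi hi'] := scale_exists (p.+1 - a).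
have m0 : (0 < 2 ^ i)%N by rewrite expn_gt0.
have m1 : i = 0%N \/ (8 * 2 ^ i <= p.+1 - a)%N by case/orP: hi' => [/eqP|]; [left|right].
have il : (i < 2 ^ i)%N by apply: ltn_expl.
have i1 : i = 0%N -> (2 ^ i = 1)%N by move=> ->.
(* [al] is a ceiling; [be] is a floor, since the window already contains [be.+1] steps to the
   right. *)
exists i, ((z - a + (2 ^ i).-1) %/ 2 ^ i)%N, ((p - z) %/ 2 ^ i)%N.
clear hi'; move: (2 ^ i)%N m0 m1 il i1 hi => m m0 m1 il i1 hi.
have e1 := divn_eq (z - a + m.-1) m.
have e2 := divn_eq (p - z) m.
have l1 : ((z - a + m.-1) %% m < m)%N by rewrite ltn_mod.
have l2 : ((p - z) %% m < m)%N by rewrite ltn_mod.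
move: ((z - a + m.-1) %/ m)%N ((p - z) %/ m)%N ((z - a + m.-1) %% m)%N ((p - z) %% m)%N e1 e2 l1 l2.
move=> A B r1 r2 e1 e2 l1 l2.
split.
- nia.
- nia.
- lia.
- by move=> y hy; rewrite /window; nia.
case: m1 => [i0|m8]; last by nia.
by rewrite (i1 i0) in e1 e2 l1 l2 *; nia.
Qed.

(** Only finitely many windows around [h q] remain, which allows a union bound. The scale is below
    [size keys] because [[a, p]] receives at least [p + 1 - a] keys and [i <= p - a]. *)
Lemma query_window h s keys q : uniq keys ->
  query h s (build h s keys) q ->
  exists x i al be, [/\ x \in keys, s x = s q,
    [/\ (al < 17)%N, (be < 16)%N & (i < size keys)%N],
    window (h q) (2 ^ i) al be (h x)
    & (4 * ((al + be.+1) * 2 ^ i) <=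
       5 * count (fun y => window (h q) (2 ^ i) al be (h y)) keys)%N].
Proof.
move=> U /(query_overfull U)[x [a [p [xk sx qa xa cn]]]].
have [i [al [be [ha hb hi W hl]]]] := interval_window qa.
exists x, i, al, be; split=> //; last 2 first.
- exact: W.
- apply: leq_trans hl _; rewrite leq_mul2l /=; apply: leq_trans cn _.
  by apply: sub_count => y /W.
split=> //; apply: leq_ltn_trans hi _; apply: leq_trans (count_size _ _).
by apply: leq_trans cn; lia.
Qed.

(** * Powers in the basis of binomial coefficients *)

Section PowersAsBinomials.
Variable R : comNzRingType.

(** Here and in the next two lemmas the coefficient of ['C(n, k)] is [k!] times a Stirling number of
    the second kind. *)
Lemma bin2_natr n : n%:R ^+ 2 = 'C(n, 2)%:R *+ 2 + n%:R :> R.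
Proof.
elim: n => [|n IH]; first by rewrite bin0n /=; ring.
rewrite binS bin1 natrD -natr1 sqrrD IH; ring.
Qed.

Lemma bin3_natr n : n%:R ^+ 3 = 'C(n, 3)%:R *+ 6 + 'C(n, 2)%:R *+ 6 + n%:R :> R.
Proof.
elim: n => [|n IH]; first by rewrite !bin0n /=; ring.
rewrite !binS bin1 !natrD -natr1.
transitivity ((n%:R ^+ 3 + n%:R ^+ 2 *+ 3 + n%:R *+ 3 + 1) : R); first by ring.
rewrite IH bin2_natr; ring.
Qed.

Lemma bin4_natr n : n%:R ^+ 4 =
  'C(n, 4)%:R *+ 24 + 'C(n, 3)%:R *+ 36 + 'C(n, 2)%:R *+ 14 + n%:R :> R.
Proof.
elim: n => [|n IH]; first by rewrite !bin0n /=; ring.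
rewrite !binS bin1 !natrD -natr1.
transitivity ((n%:R ^+ 4 + n%:R ^+ 3 *+ 4 + n%:R ^+ 2 *+ 6 + n%:R *+ 4 + 1) : R); first by ring.
rewrite IH bin3_natr bin2_natr; ring.
Qed.

End PowersAsBinomials.

(** * Moments under 5-independence *)

Section FiveIndependence.
Variables (R : realFieldType) (I : finType) (ph : I -> R) (hf : I -> nat -> nat).
Variables (u t : nat).
Hypotheses (t_gt0 : (0 < t)%N) (u_ge5 : (5 <= u)%N).
Hypotheses (hmap : maps_into hf u t) (hind : five_independent ph hf u t).

Let mean (f : nat -> R) : R := (\sum_(y < t) f y) / t%:R.

(** Each factor is expanded over the values of its hash. After distributing and exchanging sums,
    each pattern [ys] has probability [1 / t ^ 5], and the sum over patterns factors again. *)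
Lemma five_independent_prod (f : nat -> nat -> R) (xs : 5.-tuple nat) :
  uniq xs -> all (fun x => (x < u)%N) xs ->
  \sum_i ph i * \prod_(x <- xs) f x (hf i x) = \prod_(x <- xs) mean (f x).
Proof.
move=> Ux xu.
transitivity (\sum_i \sum_(ys : {ffun 'I_5 -> 'I_t})
    (\prod_k f (tnth xs k) (ys k)) *
    (ph i * [forall k, hf i (tnth xs k) == ys k]%:R)).
  apply: eq_bigr => i _; rewrite big_tuple.
  transitivity (ph i * \prod_(k < 5) \sum_(y < t)
      f (tnth xs k) y * (hf i (tnth xs k) == y)%:R).
    congr (_ * _); apply: eq_bigr => k _.
    have hl : (hf i (tnth xs k) < t)%N by apply/hmap/(allP xu)/mem_tnth.
    rewrite (bigD1 (Ordinal hl)) //= eqxx mulr1 big1 ?addr0 // => y yn.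
    case: eqP => [E|_]; last by rewrite mulr0.
    by case/eqP: yn; apply/val_inj; rewrite /= E.
  rewrite bigA_distr_bigA mulr_sumr; apply: eq_bigr => ys _.
  rewrite big_split /= mulrCA; congr (_ * (_ * _)).
  case: forallP => [H|/forallP].
    by rewrite big1 // => k _; rewrite (H k).
  rewrite negb_forall => /existsP[k nk].
  by rewrite (bigD1 k) //= (negbTE nk) mul0r.
rewrite exchange_big /=.
transitivity (\sum_(ys : {ffun 'I_5 -> 'I_t}) \prod_(k < 5) (f (tnth xs k) (ys k) / t%:R)).
  apply: eq_bigr => ys _; rewrite -mulr_sumr big_split /=; congr (_ * _).
  rewrite prodr_const card_ord exprVn -div1r.
  rewrite -(@hind xs [tuple (ys k : nat) | k < 5] Ux xu); last first.
    by apply/allP => y /mapP[k _ ->].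
  apply: eq_bigr => i _; congr (_ * (nat_of_bool _)%:R).
  by apply: eq_forallb => k; rewrite tnth_mktuple.
rewrite -(bigA_distr_bigA (fun (k : 'I_5) (y : 'I_t) => f (tnth xs k) y / t%:R)).
rewrite big_tuple; apply: eq_bigr => k _.
by rewrite /mean mulr_suml.
Qed.

Lemma fresh_key xs : (size xs < 5)%N -> exists2 x, (x < u)%N & x \notin xs.
Proof.
move=> sx.
have /negP : ~~ all [in xs] (iota 0 5).
  apply/negP => /allP H; have := uniq_leq_size (iota_uniq 0 5) H.
  by rewrite size_iota; lia.
move=> /negP; rewrite -has_predC => /hasP[x]; rewrite mem_iota => xl xn.
by exists x => //; lia.
Qed.

(** Shorter lists are padded to length 5 by fresh keys carrying the constant factor 1, whose mean is
    1. *)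
Lemma independent_prod (f : nat -> nat -> R) (xs : seq nat) :
  uniq xs -> all (fun x => (x < u)%N) xs -> (size xs <= 5)%N ->
  \sum_i ph i * \prod_(x <- xs) f x (hf i x) = \prod_(x <- xs) mean (f x).
Proof.
move: {2}(5 - size xs)%N (erefl (5 - size xs)%N) => d.
elim: d f xs => [|d IH] f xs hd Ux xu sx.
  have s5 : size xs == 5 by lia.
  exact: (@five_independent_prod f (Tuple s5)).
have sx5 : (size xs < 5)%N by lia.
have [x xl xn] := fresh_key sx5.
pose g y := if y == x then fun=> 1 else f y.
have gf y : y \in xs -> g y = f y.
  by rewrite /g; case: eqP => // -> xin; rewrite xin in xn.
have hd' : (5 - size (x :: xs))%N = d by rewrite /=; lia.
have := IH g (x :: xs) hd'; rewrite /= xn Ux xl xu => /(_ isT isT sx5).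
have mx : mean (g x) = 1.
  rewrite /mean /g eqxx sumr_const card_ord divff // pnatr_eq0; lia.
rewrite big_cons mx mul1r => H.
rewrite -[RHS](eq_big_seq (F1 := fun y => mean (g y))); last by move=> y /gf ->.
rewrite -H; apply: eq_bigr => i _; rewrite big_cons {1}/g eqxx mul1r.
by congr (_ * _); apply: eq_big_seq => y /gf ->.
Qed.

Variables (q z : nat) (J : pred nat).
Hypotheses (q_lt : (q < u)%N) (z_lt : (z < t)%N).

Let pi : R := mean (fun y => (J y)%:R).

(** The event [hf i q = z] takes one of the five independent values and contributes [1 / t]; four
    remain, enough for a fourth moment. *)
Lemma prod_conditional (A : seq nat) :
  uniq (q :: A) -> all (fun x => (x < u)%N) A -> (size A <= 4)%N ->
  \sum_i ph i * ((hf i q == z)%:R * \prod_(x <- A) (J (hf i x))%:R)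
  = t%:R^-1 * pi ^+ size A.
Proof.
move=> UA Au sA; have /andP[qA _] := UA.
pose f x y : R := if x == q then (y == z)%:R else (J y)%:R.
have fA x : x \in A -> f x = fun y => (J y)%:R.
  by rewrite /f; case: eqP => // -> xin; rewrite xin in qA.
have := @independent_prod f (q :: A) UA _ _; rewrite /= q_lt Au => /(_ isT sA).
rewrite big_cons => H.
transitivity (mean (f q) * \prod_(j <- A) mean (f j)).
  rewrite -H; apply: eq_bigr => i _; rewrite big_cons {1}/f eqxx.
  by congr (_ * (_ * _)); apply: eq_big_seq => x /fA ->.
congr (_ * _).
  rewrite /mean (bigD1 (Ordinal z_lt)) //= big1 ?addr0 /f ?eqxx ?mul1r //.
  by move=> y yz; case: eqP => // E; case/eqP: yz; apply/val_inj.
rewrite (eq_big_seq (fun=> pi)); last by move=> x /fA ->.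
by rewrite big_const_seq count_predT iter_mulr mulr1.
Qed.

(* By Pascal's rule, splitting off one key of [S] either discards it or moves it to [A]. *)
Lemma binomial_moment (S A : seq nat) (k : nat) :
  uniq (q :: A ++ S) -> all (fun x => (x < u)%N) (A ++ S) ->
  (size A + k <= 4)%N ->
  \sum_i ph i * ((hf i q == z)%:R * \prod_(x <- A) (J (hf i x))%:R
      * 'C(count (fun x => J (hf i x)) S, k)%:R)
  = t%:R^-1 * pi ^+ size A * ('C(size S, k)%:R * pi ^+ k).
Proof.
elim: S A k => [|y S IH] A k.
  rewrite cats0 => UA Au sA; rewrite /= bin0n.
  under eq_bigr do rewrite mulrA.
  rewrite -mulr_suml prod_conditional //; last by lia.
  by case: k {sA} => [|k]; rewrite ?expr0 ?mulr1 // !mul0r mulr0.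
move=> U Au sA.
have pU : perm_eq (q :: A ++ y :: S) (q :: y :: A ++ S).
  by rewrite perm_cons -cat1s perm_catCA.
have U1 : uniq (q :: (y :: A) ++ S) by rewrite -(perm_uniq pU).
have Au1 : all (fun x => (x < u)%N) ((y :: A) ++ S).
  by move: Au; rewrite /= !all_cat /=; lia.
have U2 : uniq (q :: A ++ S).
  by apply: subseq_uniq U1; rewrite /= eqxx; exact: subseq_cons.
have Au2 : all (fun x => (x < u)%N) (A ++ S) by case/andP: Au1.
case: k sA => [|k] sA.
  have := IH A 0%N U2 Au2 sA; rewrite !bin0 => <-.
  by apply: eq_bigr => i _; rewrite !bin0.
transitivity (t%:R^-1 * pi ^+ size A * ('C(size S, k.+1)%:R * pi ^+ k.+1) +
   t%:R^-1 * pi ^+ (size A).+1 * ('C(size S, k)%:R * pi ^+ k)); last first.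
  by rewrite /= binS natrD !exprS; ring.
rewrite -(IH A k.+1) // -(IH (y :: A) k) //=; last by lia.
rewrite -big_split; apply: eq_bigr => i _ /=; rewrite big_cons.
case: (J (hf i y)); rewrite /= ?add1n ?add0n ?binS ?natrD; ring.
Qed.

(** Up to the factor [1 / t], the binomial moments of the count are those of a binomial variable
    with parameters [n] and [pi]; hence so is the fourth central moment. *)
Lemma fourth_central_moment (S : seq nat) (n : R := (size S)%:R) :
  uniq (q :: S) -> all (fun x => (x < u)%N) S ->
  \sum_i ph i * ((hf i q == z)%:R *
      ((count (fun x => J (hf i x)) S)%:R - n * pi) ^+ 4)
  = t%:R^-1 * (n * pi * (1 - pi) * (1 + 3 * (n - 2) * pi * (1 - pi))).
Proof.
move=> US Su; pose N i := count (fun x => J (hf i x)) S.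
have moment k : (k <= 4)%N ->
    \sum_i ph i * ((hf i q == z)%:R * 'C(N i, k)%:R)
    = t%:R^-1 * ('C(size S, k)%:R * pi ^+ k).
  move=> k4; have := @binomial_moment S [::] k US Su k4.
  rewrite mulr1 => <-; apply: eq_bigr => i _.
  by rewrite big_nil mulr1.
pose mu := n * pi.
(* The list holds the coefficients of [(N - mu) ^ 4] in the basis ['C(N, k)]. *)
transitivity (\sum_(k < 5) nth 0 [:: mu ^+ 4; 1 - 4 * mu + 6 * mu ^+ 2 - 4 * mu ^+ 3;
    14 - 24 * mu + 12 * mu ^+ 2; 36 - 24 * mu; 24] k *
    (t%:R^-1 * ('C(size S, k)%:R * pi ^+ k))).
  under [RHS]eq_bigr => k _ do rewrite -(moment k (leq_ord k)) mulr_sumr.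
  rewrite exchange_big; apply: eq_bigr => i _.
  rewrite -/(N i) -/mu !big_ord_recr big_ord0 /= bin0 bin1.
  transitivity (ph i * ((hf i q == z)%:R * ((N i)%:R ^+ 4 - 4 * mu * (N i)%:R ^+ 3
    + 6 * mu ^+ 2 * (N i)%:R ^+ 2 - 4 * mu ^+ 3 * (N i)%:R + mu ^+ 4))); first by ring.
  by rewrite bin4_natr bin3_natr bin2_natr; ring.
have e2 : 'C(size S, 2)%:R = (n ^+ 2 - n) / 2 :> R by rewrite bin2_natr; field.
have e3 : 'C(size S, 3)%:R = (n ^+ 3 - 3 * n ^+ 2 + 2 * n) / 6 :> R.
  by rewrite bin3_natr bin2_natr; field.
have e4 : 'C(size S, 4)%:R = (n ^+ 4 - 6 * n ^+ 3 + 11 * n ^+ 2 - 6 * n) / 24 :> R.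
  by rewrite bin4_natr bin3_natr bin2_natr; field.
rewrite !big_ord_recr big_ord0 /= bin0 bin1 e2 e3 e4 -/n /mu; field.
by rewrite pnatr_eq0; lia.
Qed.

Lemma fourth_central_moment_le (S : seq nat) (n : R := (size S)%:R) :
  uniq (q :: S) -> all (fun x => (x < u)%N) S ->
  \sum_i ph i * ((hf i q == z)%:R *
      ((count (fun x => J (hf i x)) S)%:R - n * pi) ^+ 4)
  <= t%:R^-1 * (n * pi + 3 * (n * pi) ^+ 2).
Proof.
move=> US Su; rewrite fourth_central_moment // -/n.
have t0 : 0 < t%:R :> R by rewrite ltr0n.
have n0 : 0 <= n by apply: ler0n.
have p0 : 0 <= pi.
  by apply: mulr_ge0; [apply: sumr_ge0 => *; exact: ler0n|rewrite invr_ge0 ltW].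
have p1 : pi <= 1.
  rewrite /pi /mean ler_pdivrMr // mul1r -[t in leRHS]card_ord -sumr_const.
  by apply: ler_sum => y _; rewrite lern1 leq_b1.
apply: ler_wpM2l; first by rewrite invr_ge0 ltW.
pose v := pi * (1 - pi).
have v0 : 0 <= v by apply: mulr_ge0; lra.
have vp : v <= pi by rewrite /v ler_piMr //; lra.
have -> : n * pi * (1 - pi) * (1 + 3 * (n - 2) * pi * (1 - pi))
  = n * v - 6 * (n * (v * v)) + 3 * (n * v) ^+ 2 by rewrite /v; ring.
have h1 : n * v <= n * pi by apply: ler_wpM2l.
have h2 : (n * v) ^+ 2 <= (n * pi) ^+ 2 by rewrite lerXn2r // nnegrE mulr_ge0.
have h3 : 0 <= n * (v * v) by do 2?apply: mulr_ge0 => //; exact: v0.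
lra.
Qed.

End FiveIndependence.

(** * Contribution of a single window *)

(** Only an inequality, since a window may reach below 0 or beyond [t]. *)
Lemma window_size (R : realFieldType) t z m al be :
  \sum_(y < t) (window z m al be y)%:R <= ((al + be.+1) * m)%:R :> R.
Proof.
rewrite -natr_sum ler_nat -(big_mkord xpredT (fun y => window z m al be y : nat)).
rewrite -(big_map (fun y => window z m al be y : nat) xpredT id) -sumnE sumn_count.
rewrite /index_iota subn0 -size_filter.
rewrite -[leqRHS](size_iota (z - al * m)); apply: uniq_leq_size.
  by rewrite filter_uniq // iota_uniq.
move=> y; rewrite mem_filter !mem_iota /window mulnDl.
by move: (al * m)%N (be.+1 * m)%N => A B; lia.
Qed.

(** With [d = N - mu], the hypotheses give [mu <= 5/6 N], so [N <= 6 d], and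
    [d >= 4/5 l - 2/3 l = 2/15 l]. Hence [N <= 6 (15/2)^3 d^4 / l^3], and 2550 rounds the constant
    up. *)
Lemma dense_le_fourth_power (R : realFieldType) (N l mu : R) :
  0 < l -> 4 * l <= 5 * N -> 3 * mu <= 2 * l -> N <= 2550 * ((N - mu) ^+ 4 / l ^+ 3).
Proof.
move=> l0 lN mul; set d := N - mu.
have Nd : N <= 6 * d by rewrite /d; lra.
have d0 : 0 < d by lra.
have ld : 2 * l <= 15 * d by rewrite /d; lra.
have cube : (2 * l) ^+ 3 <= (15 * d) ^+ 3 by rewrite lerXn2r // nnegrE; lra.
have {}cube : d * (8 * l ^+ 3) <= d * (3375 * d ^+ 3).
  by rewrite ler_pM2l //; move: cube; rewrite !exprMn; lra.
have l3 : 0 < l ^+ 3 by apply: exprn_gt0.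
apply: le_trans Nd _; rewrite mulrA ler_pdivlMr //.
have d4 : 0 < d ^+ 4 by apply: exprn_gt0.
have e : d * d ^+ 3 = d ^+ 4 by rewrite -exprS.
nra.
Qed.

(** The load bound gives [mu <= 2/3 l], so with [l >= 1] the fourth moment is at most [2 l^2 / t].
    Multiplying by [2550 / l^3] gives [5100 / (t l)], and [m <= l]. *)
Lemma window_moment (R : realFieldType) (I : finType) (ph : I -> R)
    (hf : I -> nat -> nat) (u t q z m al be : nat) (keys : seq nat)
    (N := fun i => count (fun x => window z m al be (hf i x)) keys) :
  (5 <= u)%N -> (0 < m)%N -> (q < u)%N -> (z < t)%N ->
  (forall i, 0 <= ph i) -> maps_into hf u t -> five_independent ph hf u t ->
  uniq (q :: keys) -> all (fun x => (x < u)%N) keys -> (3 * size keys <= 2 * t)%N ->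
  \sum_i ph i * ((hf i q == z)%:R *
     ((4 * ((al + be.+1) * m) <= 5 * N i)%N%:R * (N i)%:R))
  <= 5100 / (t%:R * m%:R).
Proof.
move=> u5 m0 qu zt ph0 hmap hind Uk ku load.
have t0 : (0 < t)%N by lia.
have T0 : 0 < t%:R :> R by rewrite ltr0n.
pose n : R := (size keys)%:R; pose l : R := ((al + be.+1) * m)%:R.
pose pi : R := (\sum_(y < t) (window z m al be y)%:R) / t%:R.
have M0 : 0 < m%:R :> R by rewrite ltr0n.
have ml : m%:R <= l by rewrite ler_nat; nia.
have l1 : 1 <= l by apply: le_trans ml; rewrite ler1n.
have l0 : 0 < l by lra.
have l3 : 0 < l ^+ 3 by apply: exprn_gt0.
have pi0 : 0 <= pi.
  by apply: mulr_ge0; [apply: sumr_ge0 => *; exact: ler0n|rewrite invr_ge0 ltW].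
have n23 : 3 * n <= 2 * t%:R by rewrite -!natrM ler_nat.
have pil : pi * t%:R <= l by rewrite divfK ?gt_eqF //; exact: window_size.
have mul : 3 * (n * pi) <= 2 * l.
  have := ler_wpM2r pi0 n23; lra.
have mu0 : 0 <= n * pi by rewrite mulr_ge0 // ler0n.
pose M i := ph i * ((hf i q == z)%:R * ((N i)%:R - n * pi) ^+ 4).
apply: (@le_trans _ _ (2550 / l ^+ 3 * \sum_i M i)).
  rewrite mulr_sumr; apply: ler_sum => i _.
  rewrite /M [leRHS]mulrCA ler_wpM2l // [leRHS]mulrCA ler_wpM2l ?ler0n //.
  (* For a sparse window the left side is 0 and an even power bounds it. *)
  case: leqP => [dense|_]; rewrite ?mul1r ?mul0r; last first.
    apply: mulr_ge0; first by rewrite mulr_ge0 // invr_ge0 ltW.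
    by rewrite (_ : 4 = 2 * 2)%N // exprM sqr_ge0.
  rewrite mulrAC -mulrA; apply: dense_le_fourth_power => //.
  by rewrite -!natrM ler_nat.
have := @fourth_central_moment_le R I ph hf u t t0 u5 hmap hind q z
  (window z m al be) qu zt keys Uk ku.
rewrite -/n -/pi => H4.
have quad : n * pi + 3 * (n * pi) ^+ 2 <= 2 * l ^+ 2.
  have h2 : (n * pi) ^+ 2 <= (2 / 3 * l) ^+ 2 by rewrite lerXn2r // ?nnegrE; lra.
  have h3 : l <= l ^+ 2 by rewrite expr2 ler_peMl; lra.
  by move: h2; rewrite exprMn; lra.
have H : \sum_i M i <= t%:R^-1 * (2 * l ^+ 2).
  by apply: le_trans H4 _; rewrite ler_wpM2l // invr_ge0 ltW.
apply: (@le_trans _ _ (5100 / (t%:R * l))).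
  apply: le_trans (ler_wpM2l _ H) _; first by rewrite mulr_ge0 // invr_ge0 ltW.
  have tn0 : t%:R != 0 :> R by rewrite gt_eqF.
  have ln0 : l != 0 by rewrite gt_eqF.
  clearbody l; rewrite le_eqVlt; apply/orP; left; apply/eqP; field.
  by rewrite tn0 ln0.
rewrite ler_wpM2l // lef_pV2 ?posrE ?mulr_gt0 //.
by rewrite ler_wpM2l // ltW.
Qed.

(** * Summation over windows and scales *)

(** Depends on [h] alone, so that signature collisions can be averaged separately. *)
Definition window_weight (R : nzRingType) (h : nat -> nat) (keys : seq nat)
    (z i al be x : nat) : R :=
  (window z (2 ^ i) al be (h x) &&
   (4 * ((al + be.+1) * 2 ^ i) <=
      5 * count (fun y => window z (2 ^ i) al be (h y)) keys)%N)%:R.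

(** A positive query yields, by [query_window], one summand equal to 1; all others are
    nonnegative. *)
Lemma query_le_weight (R : realFieldType) h s keys q : uniq keys ->
  (query h s (build h s keys) q)%:R <= \sum_(x <- keys) (s x == s q)%:R *
    \sum_(i < size keys) \sum_(al < 17) \sum_(be < 16)
      window_weight R h keys (h q) i al be x.
Proof.
move=> U; case E: (query _ _ _ _); last first.
  by do 4?[apply: sumr_ge0 => *; rewrite ?mulr_ge0 //]; rewrite ler0n.
have [x [i [al [be [xk sx [ha hb hi] W D]]]]] := query_window U E.
have w0 i' al' be' y : 0 <= window_weight R h keys (h q) i' al' be' y by exact: ler0n.
have s1 i' al' y : 0 <= \sum_(be' < 16) window_weight R h keys (h q) i' al' be' y.
  exact: sumr_ge0.
have s2 i' y : 0 <= \sum_(al' < 17) \sum_(be' < 16) window_weight R h keys (h q) i' al' be' y.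
  exact: sumr_ge0.
rewrite (bigD1_seq x) //= sx eqxx mul1r ler_wpDr //.
  by apply: sumr_ge0 => y _; rewrite mulr_ge0 // sumr_ge0.
rewrite (bigD1 (Ordinal hi)) //= ler_wpDr ?sumr_ge0 //.
rewrite (bigD1 (Ordinal ha)) //= ler_wpDr ?sumr_ge0 //.
rewrite (bigD1 (Ordinal hb)) //= ler_wpDr ?sumr_ge0 //.
by rewrite /window_weight W D.
Qed.

Lemma sum_window_weight (R : realFieldType) h keys z i al be
    (N := count (fun y => window z (2 ^ i) al be (h y)) keys) :
  \sum_(x <- keys) window_weight R h keys z i al be x
  = (4 * ((al + be.+1) * 2 ^ i) <= 5 * N)%N%:R * N%:R.
Proof.
rewrite /window_weight -/N; case: leq => /=; last first.
  by rewrite mul0r big1 // => x _; rewrite andbF.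
under eq_bigr do rewrite andbT.
by rewrite mul1r /N -sum1_count natr_sum [RHS]big_mkcond; apply: eq_bigr => x _; case: window.
Qed.

Lemma sum_halves_le2 (R : realFieldType) n : \sum_(i < n) (2 ^ i)%:R^-1 <= 2 :> R.
Proof.
suff -> : \sum_(i < n) (2 ^ i)%:R^-1 = 2 - 2 / (2 ^ n)%:R :> R.
  by rewrite gerBl divr_ge0 // ler0n.
elim: n => [|n IH]; first by rewrite big_ord0 expn0; field.
rewrite big_ord_recr IH expnS natrM /=; field.
by rewrite pnatr_eq0 -lt0n expn_gt0.
Qed.

(** Splitting over [z = h q] fixes each window, and the factors [1 / t] sum to 1. There are
    [17 * 16 = 272] windows per scale, each costing [5100 / 2 ^ i], and the scales sum to at most
    2. *)
Lemma expected_weight (R : realFieldType) (I : finType) (ph : I -> R)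
    (hf : I -> nat -> nat) (u t q : nat) (keys : seq nat) :
  (5 <= u)%N -> (0 < t)%N -> (q < u)%N ->
  (forall i, 0 <= ph i) -> maps_into hf u t -> five_independent ph hf u t ->
  uniq (q :: keys) -> all (fun x => (x < u)%N) keys -> (3 * size keys <= 2 * t)%N ->
  \sum_c ph c * \sum_(x <- keys) \sum_(i < size keys) \sum_(al < 17) \sum_(be < 16)
      window_weight R (hf c) keys (hf c q) i al be x
  <= (272 * 51 * 200)%:R.
Proof.
move=> u5 t0 qu ph0 hmap hind Uk ku load.
have T0 : 0 < t%:R :> R by rewrite ltr0n.
pose F c z (i : 'I_(size keys)) (al : 'I_17) (be : 'I_16) : R :=
  \sum_(x <- keys) window_weight R (hf c) keys z i al be x.
have -> : \sum_c ph c * \sum_(x <- keys) \sum_(i < size keys) \sum_(al < 17) \sum_(be < 16)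
      window_weight R (hf c) keys (hf c q) i al be x =
    \sum_(i < size keys) \sum_(al < 17) \sum_(be < 16) \sum_(z < t)
      \sum_c ph c * ((hf c q == z)%:R * F c z i al be).
  transitivity (\sum_c \sum_(i < size keys) \sum_(al < 17) \sum_(be < 16) \sum_(z < t)
      ph c * ((hf c q == z)%:R * F c z i al be)).
    apply: eq_bigr => c _; rewrite exchange_big mulr_sumr; apply: eq_bigr => i _.
    rewrite exchange_big mulr_sumr; apply: eq_bigr => al _.
    rewrite exchange_big mulr_sumr; apply: eq_bigr => be _.
    (* Only the summand with [z = hf c q] survives. *)
    rewrite (bigD1 (Ordinal (@hmap c q qu))) //= eqxx mul1r [X in _ + X]big1 ?addr0 // => z zn.
    case: eqP => [E|_]; last by rewrite mul0r mulr0.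
    by case/eqP: zn; apply/val_inj.
  rewrite exchange_big; apply: eq_bigr => i _.
  rewrite exchange_big; apply: eq_bigr => al _.
  rewrite exchange_big; apply: eq_bigr => be _.
  by rewrite exchange_big.
have bound i al be : \sum_(z < t) \sum_c ph c * ((hf c q == z)%:R * F c z i al be)
    <= 5100 * (2 ^ i)%:R^-1.
  apply: (@le_trans _ _ (\sum_(z < t) 5100 / (t%:R * (2 ^ i)%:R))).
    apply: ler_sum => z _; rewrite /F.
    under eq_bigr do rewrite sum_window_weight.
    by apply: (window_moment (u := u)); rewrite ?expn_gt0.
  rewrite sumr_const card_ord -[leLHS]mulr_natr le_eqVlt; apply/orP; left; apply/eqP; field.
  by rewrite (gt_eqF T0) pnatr_eq0 -lt0n expn_gt0.
apply: (@le_trans _ _ (\sum_(i < size keys) (5100 * 272) * (2 ^ i)%:R^-1)).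
  apply: ler_sum => i _; rewrite -mulrA [272 * _]mulrC mulrA.
  apply: (@le_trans _ _ (\sum_(al < 17) \sum_(be < 16) 5100 * (2 ^ i)%:R^-1)).
    by do 2!apply: ler_sum => ? _.
  rewrite !sumr_const !card_ord -mulrnA -[leLHS]mulr_natr; lra.
rewrite -mulr_sumr.
apply: le_trans (ler_wpM2l _ (sum_halves_le2 R (size keys))) _; first by lra.
by rewrite !natrM; lra.
Qed.

(** * Averaging over signatures *)

(** As [W] does not involve the signature index [j], averaging over [ps] affects only the collision
    indicators, and universality bounds each average by [1 / 2 ^ b]. *)
Lemma signature_union_bound (R : realFieldType) (I J : finType)
    (ph : I -> R) (hf : I -> nat -> nat) (ps : J -> R) (sf : J -> nat -> nat)
    (u b : nat) (keys : seq nat) (q : nat) (W : I -> nat -> R) (B : R) :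
  all (fun x => (x < u)%N) keys -> (q < u)%N -> q \notin keys ->
  (forall i, 0 <= ph i) -> (forall j, 0 <= ps j) -> universal ps sf u b ->
  (forall i x, 0 <= W i x) ->
  (forall i j, (query (hf i) (sf j) (build (hf i) (sf j) keys) q)%:R
     <= \sum_(x <- keys) (sf j x == sf j q)%:R * W i x) ->
  \sum_i ph i * \sum_(x <- keys) W i x <= B ->
  false_pos_prob ph hf ps sf keys q <= B / 2 ^+ b.
Proof.
move=> ku qu qk ph0 ps0 univ W0 qW WB; rewrite /false_pos_prob.
apply: (@le_trans _ _ (\sum_i ph i * \sum_(x <- keys)
   (\sum_j ps j * (sf j x == sf j q)%:R) * W i x)).
  apply: ler_sum => i _.
  have -> : \sum_(x <- keys) (\sum_j ps j * (sf j x == sf j q)%:R) * W i x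
      = \sum_j ps j * \sum_(x <- keys) (sf j x == sf j q)%:R * W i x.
    under eq_bigr do rewrite mulr_suml.
    rewrite exchange_big; apply: eq_bigr => j _; rewrite mulr_sumr.
    by apply: eq_bigr => x _; rewrite mulrA.
  rewrite mulr_sumr; apply: ler_sum => j _; rewrite -mulrA.
  by apply/ler_wpM2l => //; apply/ler_wpM2l.
have b0 : 0 <= (2 ^+ b)^-1 :> R by rewrite invr_ge0 exprn_ge0.
apply: le_trans (ler_wpM2r b0 WB).
rewrite mulr_suml; apply: ler_sum => i _; rewrite -mulrA ler_wpM2l //.
rewrite mulr_suml big_seq [leRHS]big_seq; apply: ler_sum => x xk.
rewrite mulrC ler_wpM2l // -div1r; apply: univ => //; first exact: (allP ku).
by apply: contraNneq qk => <-.
Qed.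

(** The crude bound for small universes; the factor 1 plays the part of [W] in
    [signature_union_bound]. *)
Lemma query_le_collisions (R : realFieldType) h s keys q : uniq keys ->
  (query h s (build h s keys) q)%:R
    <= \sum_(x <- keys) (s x == s q)%:R * 1 :> R.
Proof.
move=> U; case E: (query _ _ _ _); last by apply: sumr_ge0 => *; rewrite mulr1 ler0n.
have [x [? [? [xk sx _ _ _]]]] := query_overfull U E.
rewrite (bigD1_seq x) //= sx eqxx mulr1 lerDl.
by apply: sumr_ge0 => *; rewrite mulr1 ler0n.
Qed.

Theorem theorem9 :
  exists C : nat,
  forall (R : realFieldType) (u t b : nat) (keys : seq nat) (q : nat)
         (I J : finType) (ph : I -> R) (hf : I -> nat -> nat)
         (ps : J -> R) (sf : J -> nat -> nat),
    (exists k : nat, t = (2 ^ k)%N) ->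
    uniq keys -> all (fun x => (x < u)%N) keys ->
    (3 * size keys <= 2 * t)%N ->
    (q < u)%N -> q \notin keys ->
    is_distr ph -> maps_into hf u t -> five_independent ph hf u t ->
    is_distr ps -> maps_into sf u (2 ^ b) -> universal ps sf u b ->
    false_pos_prob ph hf ps sf keys q <= C%:R / (2%:R ^+ b).
Proof.
exists (272 * 51 * 200)%N => R u t b keys q I J ph hf ps sf [k tE] Uk ku load qu qk.
move=> [ph0 ph1] hmap hind [ps0 ps1] _ univ.
have t0 : (0 < t)%N by rewrite tE expn_gt0.
have [u5|u4] := leqP 5 u; last first.
  (* [five_independent] is vacuous here, but there are at most four keys. *)
  apply: (signature_union_bound (u := u) (W := fun _ _ => 1)) => //.
    by move=> i j; exact: query_le_collisions.
  rewrite -mulr_suml ph1 mul1r big_const_seq count_predT iter_addr_0.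
  have ks : (size keys <= 4)%N.
    rewrite -(size_iota 0 4); apply: uniq_leq_size => // x /(allP ku) xu.
    by rewrite mem_iota; lia.
  by rewrite ler_nat (leq_trans ks) // !muln_gt0.
apply: (signature_union_bound (u := u)
  (W := fun c x => \sum_(i < size keys) \sum_(al < 17) \sum_(be < 16)
      window_weight R (hf c) keys (hf c q) i al be x)) => //.
- by move=> c x; do 3!apply: sumr_ge0 => ? _; exact: ler0n.
- by move=> c j; exact: query_le_weight.
by apply: expected_weight hind _ ku load => //=; rewrite qk.
Qed.
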